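(* Let $p\ge 3$ be an odd integer and $q\ge 2$ an even integer. For $r\in\{p,q\}$ and $m\in\mathbb{Z}_{\ge 0}$ put $d_r(m)=\frac{2m+r-1}{r-1}\binom{m+r-2}{m}$. Let $N^{+}(s)$ and $N^{-}(s)$ be the numbers of eigenvalues, counted with multiplicity, in $(0,s]$ and in $[-s,0)$ respectively, of $\Box=-\Delta_x+\Delta_y$ on $S^p\times S^q$ ($x\in S^p$, $y\in S^q$); that is, $$N^{+}(s)=\sum_{\substack{j,k\in\mathbb{Z}_{\ge 0}\\ 0<j(j+p-1)-k(k+q-1)\le s}}d_p(j)\,d_q(k),\qquad N^{-}(s)=\sum_{\substack{j,k\in\mathbb{Z}_{\ge 0}\\ 0<k(k+q-1)-j(j+p-1)\le s}}d_p(j)\,d_q(k).$$ Then, as $s\to\infty$, both satisfy $$N^{\pm}(s)=\frac{4}{(p+q-1)\,(p-1)!\,(q-1)!}\left(1-2^{-(p+q-1)}\right)\zeta(p+q-1)\,s^{p+q-1}+O(s^{p+q-2}).$$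
   Context: $\Delta_x,\Delta_y$ are the (nonpositive) Laplacians on the standard unit spheres $S^p$ and $S^q$. The eigenfunctions of $\Box$ are products $Y_j^p(x)Y_k^q(y)$ of spherical harmonics of degrees $j,k\ge 0$, with eigenvalue $j(j+p-1)-k(k+q-1)$; the space of spherical harmonics of degree $m$ on $S^r$ ($r\ge 2$) has dimension $d_r(m)$. $\zeta$ is the Riemann zeta function. The integers $p,q$ are fixed; the implied constant may depend on $p$ and $q$. *)

(* Defs.v *)
From mathcomp Require Import all_boot all_order all_algebra.
From mathcomp Require Import all_classical all_reals all_analysis.
Import Order.TTheory GRing.Theory Num.Theory.
Import numFieldNormedType.Exports.

Set Implicit Arguments.
Unset Strict Implicit.
Unset Printing Implicit Defensive.

Local Open Scope classical_set_scope.
Local Open Scope ring_scope.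

(* d_r(m), the dimension of the space of spherical harmonics of degree m on the
   unit sphere S^r. Intended for 2 <= r, where no subtraction truncates. *)
Definition harmonic_dim (R : realType) (r m : nat) : R :=
  (2 * m + r - 1)%N%:R / (r - 1)%N%:R * 'C(m + r - 2, m)%:R.

(* The eigenvalue m(m+r-1) of minus the Laplacian on S^r, for 1 <= r. *)
Definition sphere_eigenvalue (R : realType) (r m : nat) : R :=
  (m * (m + r - 1))%N%:R.

Definition box_eigenvalue (R : realType) (p q : nat) (jk : nat * nat) : R :=
  sphere_eigenvalue R p jk.1 - sphere_eigenvalue R q jk.2.

(* Number of eigenvalues in I, with multiplicity. The sum is taken in \bar R, so
   that it equals +oo, rather than a default value, when infinitely many
   eigenvalues lie in I. *)
Definition box_count (R : realType) (p q : nat) (I : set R) : \bar R :=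
  \esum_(jk in [set jk : nat * nat | I (box_eigenvalue R p q jk)])
    (harmonic_dim R p jk.1 * harmonic_dim R q jk.2)%:E.

Definition Nplus (R : realType) (p q : nat) (s : R) : \bar R :=
  box_count p q `]0, s]%classic.

Definition Nminus (R : realType) (p q : nat) (s : R) : \bar R :=
  box_count p q `[- s, 0[%classic.

(* The Riemann zeta function at a real argument x > 1. *)
Definition zeta (R : realType) (x : R) : R :=
  limn (series (fun n : nat => n.+1%:R `^ (- x))).

(* The coefficient of s^(p+q-1) in the asymptotics of both counting functions. *)
Definition weyl_constant (R : realType) (p q : nat) : R :=
  4 / ((p + q - 1)%:R * (p - 1)`!%:R * (q - 1)`!%:R)
  * (1 - 2 ^- (p + q - 1)) * zeta (p + q - 1)%:R.

(* Main.v *)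
Require Import Defs.
From mathcomp Require Import all_boot all_order all_algebra.
From mathcomp Require Import all_classical all_reals all_analysis.
From mathcomp Require Import ring lra zify.
Import Order.TTheory GRing.Theory Num.Theory.
Import numFieldNormedType.Exports.
Local Open Scope classical_set_scope.
Local Open Scope ring_scope.

(** Write u = 2j + p - 1 and v = 2k + q - 1.  Completing squares gives
[4 lambda = u^2 - v^2 - c] with [c = (p-1)^2 - (q-1)^2].  Since p + q is odd,
u and v have opposite parities, so m = u - v is odd, and u^2 - v^2 = m n
with n = u + v.  Counting eigenvalues in (0, s] becomes counting pairs (m, n)
with m n <= Y = 4 s + c under the hyperbola; the pairs with u < v and a positive
eigenvalue lie in a fixed box and contribute O(1).

Put d = p + q - 2.  The dimension d_r(m') is 2/(r-1)! times a product of r - 1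
factors which are all close to half of u (or v), hence to n/4.  The multiplicity
is therefore K n^d + O(m n^(d-1)), where K = 4 / (4^d (p-1)! (q-1)!)
([row_term_approx]).

For a fixed m the possible n form an arithmetic progression of step 4, so that
the sum of K n^d over n <= X = Y/m is K X^(d+1) / (4 (d+1)) + O(m X^d)
([sum_pow_arith_prog], [hyperbola_row]).  This holds for every X >= 0, also when
the row is empty, so the sum may run over all odd m.  The main terms add up to
K Y^(d+1) / (4 (d+1)) times the sum of m^-(d+1) over odd m, which is
(1 - 2^-(d+1)) zeta(d+1) ([cvg_odd_zeta]); the errors add up to Y^d times the sum
of m^(1-d), which converges because d >= 3 ([hyperbola_sum]).

Exchanging the two spheres changes the sign of the eigenvalues and leaves the
parity of p + q and the constant unchanged, so the negative eigenvalues are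
covered by the same estimate ([Nminus_swap]). *)

(** * Power sums over arithmetic progressions *)

(** Replacing the factors of a product one at a time by a nearby [t] costs at
most [e] times the size of the other factors. *)
Lemma norm_prod_sub_exp {R : realDomainType} (x : nat -> R) (t b e : R) n :
  `|t| <= b -> (forall i, (i < n.+1)%N -> `|x i| <= b) ->
  (forall i, (i < n.+1)%N -> `|x i - t| <= e) ->
  `|\prod_(i < n.+1) x i - t ^+ n.+1| <= n.+1%:R * e * b ^+ n.
Proof.
move=> tb; elim: n => [|n IHn] xb xe.
  by rewrite big_ord1 expr1 mul1r mulr1 xe.
rewrite big_ord_recr /= exprS.
have b0 : 0 <= b by exact: le_trans tb.
have -> : \prod_(i < n.+1) x i * x n.+1 - t * t ^+ n.+1 =
    x n.+1 * (\prod_(i < n.+1) x i - t ^+ n.+1) + (x n.+1 - t) * t ^+ n.+1.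
  by ring.
apply: le_trans (ler_normD _ _) _; rewrite !normrM normrX.
have -> : n.+2%:R * e * b ^+ n.+1 = b * (n.+1%:R * e * b ^+ n) + e * b ^+ n.+1.
  by rewrite -[n.+2]addn1 natrD exprS; ring.
apply: lerD; apply: ler_pM => //; rewrite ?xb ?xe ?lerXn2r //.
by apply: IHn => i ilt; [apply: xb | apply: xe]; apply: ltnW.
Qed.

Lemma exprD_sub_bounds {R : realDomainType} (x h : R) n : 0 <= x -> 0 <= h ->
  n.+1%:R * h * x ^+ n <= (x + h) ^+ n.+1 - x ^+ n.+1
    <= n.+1%:R * h * (x + h) ^+ n.
Proof.
move=> x0 h0; have xh0 : 0 <= x + h by exact: addr_ge0.
elim: n => [|n /andP[IH1 IH2]]; first by rewrite !expr1 !mulr1 !mul1r; lra.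
have xX : x ^+ n.+1 <= (x + h) ^+ n.+1 by rewrite lerXn2r // lerDl.
have -> : (x + h) ^+ n.+2 - x ^+ n.+2 =
    (x + h) * ((x + h) ^+ n.+1 - x ^+ n.+1) + h * x ^+ n.+1.
  by rewrite !(exprS _ n.+1); ring.
have hX : h * x ^+ n.+1 <= h * (x + h) ^+ n.+1 by exact: ler_wpM2l.
have E y : n.+2%:R * h * y ^+ n.+1 = y * (n.+1%:R * h * y ^+ n) + h * y ^+ n.+1.
  by rewrite -[n.+2]addn1 natrD (exprS _ n); ring.
rewrite !E; apply/andP; split.
  rewrite lerD2r; apply: le_trans (ler_wpM2l xh0 IH1).
  by rewrite ler_wpM2r ?lerDl // !mulr_ge0 ?exprn_ge0.
by apply: lerD => //; apply: ler_wpM2l.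
Qed.

(** Each term times the step is at most the increment of x^(n+1) / (n+1) that
starts at it, and the increments telescope. *)
Lemma arith_prog_sum_upper {R : realDomainType} (a h : R) n L :
  0 <= a -> 0 <= h ->
  n.+1%:R * h * (\sum_(k < L) (a + k%:R * h) ^+ n) <=
    (a + L%:R * h) ^+ n.+1 - a ^+ n.+1.
Proof.
move=> a0 h0; elim: L => [|L IH].
  by rewrite big_ord0 mul0r addr0 mulr0 subrr.
have /andP[+ _] := exprD_sub_bounds _ h n (addr_ge0 a0 (mulr_ge0 (ler0n R L) h0)) h0.
by rewrite big_ord_recr /= mulrDr -(natr1 L) mulrDl mul1r addrA; lra.
Qed.

(** Each term but the first, times the step, is at least the increment of
x^(n+1) / (n+1) that ends at it, whence the extra term in the sum. *)
Lemma arith_prog_sum_lower {R : realDomainType} (a h : R) n L :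
  0 <= a -> 0 <= h ->
  (a + L%:R * h) ^+ n.+1 - a ^+ n.+1 <=
  n.+1%:R * h * (\sum_(k < L.+1) (a + k%:R * h) ^+ n).
Proof.
move=> a0 h0; elim: L => [|L IH].
  rewrite mul0r addr0 subrr !mulr_ge0 ?sumr_ge0 // => i _.
  by rewrite exprn_ge0 // addr_ge0 ?mulr_ge0.
have /andP[_ +] := exprD_sub_bounds _ h n (addr_ge0 a0 (mulr_ge0 (ler0n R L) h0)) h0.
rewrite big_ord_recr /= mulrDr -!(natr1 L) mulrDl mul1r addrA; lra.
Qed.

(** The length of the initial segment is fixed by the cutoff alone, so one [L]
serves every [M] for which the progression passes [X]. *)
Lemma arith_prog_cutoff {R : realType} (a X : R) : a <= X ->
  exists L : nat, [/\ a + L%:R * 4 <= X, X < a + L.+1%:R * 4 &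
    forall (M : nat) (F : nat -> R), X < a + M%:R * 4 ->
      \sum_(k < M | a + k%:R * 4 <= X) F k = \sum_(k < L.+1) F k].
Proof.
move=> aX; have y0 : 0 <= (X - a) / 4 by lra.
have E k : (a + k%:R * 4 <= X) = (k%:R <= (X - a) / 4) by apply/idP/idP; lra.
exists (Num.Def.trunc ((X - a) / 4)); split.
- by rewrite E truncn_le.
- by have /andP[_] := truncn_itv y0; lra.
- move=> M F XM.
  have kL k : (a + k%:R * 4 <= X) = (k < (Num.Def.trunc ((X - a) / 4)).+1)%N.
    by rewrite ltnS truncn_ge_nat // E.
  have LM : ((Num.Def.trunc ((X - a) / 4)).+1 <= M)%N.
    by rewrite leqNgt; apply/negP; rewrite -kL leNgt XM.
  by under eq_bigl do rewrite kL; rewrite (big_ord_narrow LM).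
Qed.

(** The factor [a >= 1] in the error absorbs what the integral of x^d / 4 picks up
below the first term, at most [a * X ^+ d]; this also makes the estimate
valid when [X < a] and the sum is empty. *)
Lemma sum_pow_arith_prog {R : realType} (a X : R) (d M : nat) :
  1 <= a -> 0 <= X -> X < a + M%:R * 4 ->
  `|\sum_(k < M | a + k%:R * 4 <= X) (a + k%:R * 4) ^+ d
    - X ^+ d.+1 / (4 * d.+1%:R)| <= (5 ^+ d + 1) * a * X ^+ d.
Proof.
move=> a1 X0 XM; have d1 : 1 <= d.+1%:R :> R by rewrite ler1n.
have d0 : 0 < 4 * d.+1%:R :> R by lra.
have Xd0 : 0 <= X ^+ d by exact: exprn_ge0.
have five1 : 1 <= 5 ^+ d :> R by rewrite exprn_ege1 // ler1n.
have [aX|Xa] := leP a X; last first.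
  rewrite big_pred0; last first.
    by move=> k; apply/negbTE; rewrite -ltNge (lt_le_trans Xa) // lerDl mulr_ge0.
  rewrite sub0r normrN ger0_norm ?divr_ge0 ?exprn_ge0 ?(ltW d0) //.
  rewrite ler_pdivrMr // exprS.
  have -> : (5 ^+ d + 1) * a * X ^+ d * (4 * d.+1%:R) =
    a * X ^+ d * ((5 ^+ d + 1) * (4 * d.+1%:R)) by ring.
  apply: (le_trans (ler_wpM2r Xd0 (ltW Xa))); rewrite ler_peMr ?mulr_ge0 //; first lra.
  by rewrite // -[leLHS]mulr1 ler_pM //; lra.
have X1 : 1 <= X by exact: le_trans aX.
have a0 : 0 <= a by lra.
have [L [LX XL sumL]] := arith_prog_cutoff a X aX.
rewrite (sumL _ (fun k => (a + k%:R * 4) ^+ d) XM).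
have four0 : 0 <= 4 :> R by [].
have y0 : 0 <= a + L%:R * 4 by rewrite addr_ge0 ?mulr_ge0.
have up := arith_prog_sum_upper a 4 d L.+1 a0 four0.
have lo := arith_prog_sum_lower a 4 d L a0 four0.
set S := \sum_(k < L.+1) _ in up lo *.
rewrite ler_norml lerBrDr lerBlDr.
have W (y z : R) : d.+1%:R * 4 * (y + z) = d.+1%:R * 4 * y + d.+1%:R * 4 * z by ring.
have d0' : 0 < d.+1%:R * 4 :> R by rewrite mulrC.
have e : d.+1%:R * 4 * (X ^+ d.+1 / (4 * d.+1%:R)) = X ^+ d.+1.
  by field; rewrite lt0r_neq0 //; lra.
have aXd : X ^+ d <= a * X ^+ d by rewrite ler_peMl.
apply/andP; split; rewrite -(ler_pM2l d0') W e.
- have aD : a ^+ d.+1 <= a * X ^+ d by rewrite exprS ler_wpM2l // lerXn2r.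
  have z0 : 0 <= X - (a + L%:R * 4) by rewrite subr_ge0.
  have /andP[_] := exprD_sub_bounds _ _ d y0 z0.
  rewrite (addrC (a + _) (X - _)) subrK => h2.
  have h3 : d.+1%:R * (X - (a + L%:R * 4)) * X ^+ d <= d.+1%:R * 4 * X ^+ d.
    rewrite -!mulrA ler_wpM2l // ler_wpM2r //; move: XL; rewrite -natr1; lra.
  have h4 : d.+1%:R * 4 * X ^+ d <= d.+1%:R * 4 * (a * X ^+ d).
    by rewrite ler_wpM2l // ltW.
  have h5 : a * X ^+ d <= d.+1%:R * 4 * (5 ^+ d * a * X ^+ d).
    rewrite -(mulrA (5 ^+ d)) mulrA ler_peMl ?mulr_ge0 //.
    by rewrite -[leLHS]mulr1 ler_pM //; lra.
  have E : d.+1%:R * 4 * - ((5 ^+ d + 1) * a * X ^+ d) =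
    - (d.+1%:R * 4 * (5 ^+ d * a * X ^+ d)) - d.+1%:R * 4 * (a * X ^+ d) by ring.
  by rewrite E; lra.
- have y4 : a + L.+1%:R * 4 <= X + 4 by rewrite -natr1; lra.
  have h1 : (a + L.+1%:R * 4) ^+ d.+1 <= (X + 4) ^+ d.+1.
    by rewrite lerXn2r ?nnegrE ?addr_ge0 ?mulr_ge0.
  have /andP[_ h2] := exprD_sub_bounds X 4 d X0 four0.
  (* X + 4 <= 5 X because 1 <= a <= X. *)
  have h3 : (X + 4) ^+ d <= 5 ^+ d * X ^+ d.
    by rewrite -exprMn lerXn2r ?nnegrE ?mulr_ge0 ?addr_ge0 //; lra.
  have h4 : 5 ^+ d * X ^+ d <= (5 ^+ d + 1) * a * X ^+ d.
    rewrite -mulrA ler_pM //; lra.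
  have h5 := le_trans h3 h4.
  have h6 : d.+1%:R * 4 * (X + 4) ^+ d <= d.+1%:R * 4 * ((5 ^+ d + 1) * a * X ^+ d).
    by rewrite ler_wpM2l // ltW.
  have : 0 <= a ^+ d.+1 by rewrite exprn_ge0.
  lra.
Qed.

(** No term exceeds X^d, and at most [X] terms are summed because [1 <= a]. *)
Lemma sum_pow_arith_prog_le {R : realType} (a X : R) (d M : nat) :
  1 <= a -> 0 <= X -> X < a + M%:R * 4 ->
  \sum_(k < M | a + k%:R * 4 <= X) (a + k%:R * 4) ^+ d <= X ^+ d.+1.
Proof.
move=> a1 X0 XM.
have [aX|Xa] := leP a X; last first.
  rewrite big_pred0 ?exprn_ge0 //.
  by move=> k; apply/negbTE; rewrite -ltNge (lt_le_trans Xa) // lerDl mulr_ge0.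
have [L [LX _ sumL]] := arith_prog_cutoff a X aX.
have LX' : L.+1%:R <= X.
  by move: LX; rewrite -natr1; have : 0 <= L%:R :> R by []; lra.
rewrite exprS (le_trans _ (ler_wpM2r (exprn_ge0 d X0) LX')) //.
rewrite (sumL _ (fun k => (a + k%:R * 4) ^+ d) XM) mulr_natl.
rewrite -[in leRHS](card_ord L.+1) -sumr_const.
apply: ler_sum => k _; rewrite lerXn2r ?nnegrE ?addr_ge0 ?mulr_ge0 //; first lra.
by rewrite (le_trans _ LX) // lerD2l ler_wpM2r // ler_nat -ltnS.
Qed.

(** * Multiplicities near the diagonal *)

(** The factor of index 0 is half of [2 * j + n.+1]; the others come from the
binomial coefficient.  All of them are [j] up to a bounded amount, so that the
product is close to a pure power. *)
Lemma harmonic_dim_prod {R : realType} n j : harmonic_dim R n.+2 j =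
  2 / n.+1`!%:R * \prod_(i < n.+1)
    (j%:R + (if (i : nat) == 0%N then n.+1%:R / 2 else i%:R)).
Proof.
have H : \prod_(i < n) (j + i.+1)%N%:R = ('C(j + n, j) * n`!)%N%:R :> R.
  have -> : ('C(j + n, j) * n`!)%N = (\prod_(i < n) (j + i.+1))%N.
    apply/eqP; rewrite -(eqn_pmul2r (fact_gt0 j)) -mulnA [(n`! * _)%N]mulnC.
    have := bin_fact (leq_addr n j); rewrite addKn => ->.
    elim: n => [|n IH]; first by rewrite addn0 big_ord0 mul1n.
    by rewrite big_ord_recr /= addnS factS (eqP IH); apply/eqP; ring.
  by rewrite natr_prod.
rewrite /harmonic_dim big_ord_recl /=.
rewrite (eq_bigr (fun i : 'I_n => (j + i.+1)%N%:R)); last first.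
  by move=> i _; rewrite /bump add1n natrD.
rewrite H.
have -> : (2 * j + n.+2 - 1 = 2 * j + n.+1)%N by lia.
have -> : (j + n.+2 - 2 = j + n)%N by lia.
rewrite subn1 factS !natrM natrD natrM /=; field.
by rewrite addrC natr1 !pnatr_eq0 -!lt0n fact_gt0.
Qed.

(** In the application [2 * j + n.+1] is u or v, [t] is u + v and [m] is |u - v|,
so that u/2 and v/2 both lie at distance [m / 4] from [t / 4]. *)
Lemma harmonic_dim_approx {R : realType} n : exists2 C : R, 0 <= C &
  forall j (m t : R), 1 <= m -> (2 * j + n.+1)%N%:R <= t ->
    `|(2 * j + n.+1)%N%:R / 2 - t / 4| <= m / 4 ->
  `|harmonic_dim R n.+2 j - 2 / n.+1`!%:R * (t / 4) ^+ n.+1| <= C * m * t ^+ n.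
Proof.
exists (2 / n.+1`!%:R * (n.+1%:R * n.+1%:R)) => [|j m t m1 jt jm].
  by rewrite mulr_ge0 ?mulr_ge0 ?divr_ge0.
rewrite harmonic_dim_prod -mulrBr normrM ger0_norm ?divr_ge0 //.
have -> : 2 / n.+1`!%:R * (n.+1%:R * n.+1%:R) * m * t ^+ n =
  2 / n.+1`!%:R * (n.+1%:R * (n.+1%:R * m) * t ^+ n) by ring.
rewrite ler_wpM2l ?divr_ge0 //.
rewrite natrD natrM in jt jm.
have j0 : 0 <= j%:R :> R by [].
have n1 : 1 <= n.+1%:R :> R by rewrite ler1n.
rewrite ler_norml in jm; case/andP: jm => jm1 jm2.
pose x i : R := j%:R + (if i == 0%N then n.+1%:R / 2 else i%:R).
have xb i : (i < n.+1)%N -> 0 <= x i <= j%:R + n.+1%:R.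
  move=> il; rewrite /x; case: ifP => _; first by lra.
  by rewrite lerD2l ler_nat (ltnW il) addr_ge0.
apply: (norm_prod_sub_exp x).
- by rewrite ger0_norm; lra.
- by move=> i /xb /andP[x0 xn]; rewrite ger0_norm //; lra.
- move=> i il; rewrite ler_norml; have := xb i il; rewrite /x.
  have i0 : 0 <= i%:R :> R by [].
  have nm : n.+1%:R <= n.+1%:R * m by rewrite ler_peMr.
  have mn : m <= n.+1%:R * m by rewrite ler_peMl //; lra.
  case: ifP => _ /andP[h1 h2]; apply/andP; split; lra.
Qed.

(** The coefficient of t^(a+b+2) in the product of the two leading terms of
[harmonic_dim_approx], for the spheres of dimensions [a.+2] and [b.+2]; this
shift makes every exponent a successor. *)
Definition leading_coef (R : realType) (a b : nat) : R :=
  4 / (4 ^+ (a + b).+2 * a.+1`!%:R * b.+1`!%:R).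

Lemma leading_coef_ge0 (R : realType) a b : 0 <= leading_coef R a b.
Proof. by rewrite /leading_coef divr_ge0 // !mulr_ge0 // exprn_ge0. Qed.

Lemma multiplicity_approx {R : realType} a b : exists2 C : R, 0 <= C &
  forall i j k (m t : R), (2 * j + a.+1 = 2 * k + b.+1 + (2 * i + 1))%N ->
  m = (2 * i + 1)%N%:R -> t = (2 * j + a.+1 + (2 * k + b.+1))%N%:R ->
  `|harmonic_dim R a.+2 j * harmonic_dim R b.+2 k -
    leading_coef R a b * t ^+ (a + b).+2| <= C * m * t ^+ (a + b).+1.
Proof.
have [C1 C10 H1] := @harmonic_dim_approx R a.
have [C2 C20 H2] := @harmonic_dim_approx R b.
exists (C1 * (2 + C2) + 2 * C2) => [|i j k m t E mE t_E].
  by rewrite addr_ge0 ?mulr_ge0 ?addr_ge0.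
have m1 : 1 <= m by rewrite mE ler1n; lia.
have mt : m <= t by rewrite mE t_E ler_nat; lia.
have tE : t = 2 * (2 * j + a.+1)%N%:R - m by rewrite t_E mE E !natrD; ring.
have tE' : t = 2 * (2 * k + b.+1)%N%:R + m by rewrite t_E mE E !natrD; ring.
have t0 : 0 <= t by rewrite t_E.
have {}H1 : `|harmonic_dim R a.+2 j - 2 / a.+1`!%:R * (t / 4) ^+ a.+1| <= C1 * m * t ^+ a.
  by apply: H1 => //; [rewrite t_E ler_nat; lia | rewrite ger0_norm; lra].
have {}H2 : `|harmonic_dim R b.+2 k - 2 / b.+1`!%:R * (t / 4) ^+ b.+1| <= C2 * m * t ^+ b.
  by apply: H2 => //; [rewrite t_E ler_nat; lia | rewrite ler0_norm; lra].
have B n : 0 <= 2 / n.+1`!%:R * (t / 4) ^+ n.+1 <= 2 * t ^+ n.+1.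
  apply/andP; split; first by rewrite mulr_ge0 ?divr_ge0 ?exprn_ge0 ?divr_ge0.
  rewrite -mulrA ler_wpM2l // -[leRHS]mul1r ler_pM ?invr_ge0 ?exprn_ge0 ?divr_ge0 //.
    by rewrite invf_le1 ?ltr0n ?fact_gt0 // ler1n fact_gt0.
  by rewrite lerXn2r ?nnegrE ?divr_ge0 //; lra.
have /andP[A0 A1] := B a; have /andP[B0 B1] := B b.
have -> : leading_coef R a b * t ^+ (a + b).+2 =
    2 / a.+1`!%:R * (t / 4) ^+ a.+1 * (2 / b.+1`!%:R * (t / 4) ^+ b.+1).
  rewrite /leading_coef -addSn -addnS !expr_div_n !exprD; field.
  by rewrite !expf_eq0 !pnatr_eq0 -!lt0n !fact_gt0.
set x := harmonic_dim R a.+2 j in H1 *; set y := harmonic_dim R b.+2 k in H2 *.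
set x0 := 2 / a.+1`!%:R * _ in H1 A0 A1 *; set y0 := 2 / b.+1`!%:R * _ in H2 B0 B1 *.
have -> : x * y - x0 * y0 = (x - x0) * y + x0 * (y - y0) by ring.
clearbody x y x0 y0.
apply: (le_trans (ler_normD _ _)); rewrite !normrM (ger0_norm A0).
have yb : `|y| <= (2 + C2) * t ^+ b.+1.
  have -> : y = y0 + (y - y0) by ring.
  apply: le_trans (ler_normD _ _) _; rewrite (ger0_norm B0) mulrDl lerD //.
  apply: le_trans H2 _; rewrite exprS -mulrA ler_wpM2l // ler_wpM2r // exprn_ge0 //.
have -> : (C1 * (2 + C2) + 2 * C2) * m * t ^+ (a + b).+1 =
  C1 * m * t ^+ a * ((2 + C2) * t ^+ b.+1) + 2 * t ^+ a.+1 * (C2 * m * t ^+ b).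
  by rewrite -addnS exprD (exprS _ a) (exprS _ b); ring.
by apply: lerD; apply: ler_pM.
Qed.

(** The [j] for which u - v = 2 i + 1.  Solving
[2 * j + a.+1 = 2 * k + b.+1 + (2 * i + 1)] for [j] halves an expression that is
even because [a + b] is odd; the halves are written so that no parity case
distinction is needed. *)
Definition row_index (a b i k : nat) : nat :=
  (k + i + (b.+1)./2.+1 - uphalf a.+1)%N.

(** Extending the multiplicity by 0 to all [i] and [k] makes every row a full
arithmetic progression of values of n. *)
Definition row_term (R : realType) (a b i k : nat) : R :=
  if ((uphalf a.+1 <= k + i + (b.+1)./2.+1)%N
      && (0 < box_eigenvalue R a.+2 b.+2 (row_index a b i k, k)))
  then harmonic_dim R a.+2 (row_index a b i k) * harmonic_dim R b.+2 k else 0.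

Lemma row_indexP a b i j k : odd (a + b) ->
  (2 * j + a.+1 = 2 * k + b.+1 + (2 * i + 1))%N <->
  (uphalf a.+1 <= k + i + (b.+1)./2.+1)%N /\ j = row_index a b i k.
Proof.
rewrite /row_index oddD => ab.
have := odd_double_half a; have := odd_double_half b.
rewrite !uphalf_half /=; move: ab; case: (odd a); case: (odd b) => //= _; lia.
Qed.

Lemma box_eigenvalueE {R : realType} a b j k :
  4 * box_eigenvalue R a.+2 b.+2 (j, k) =
  (2 * j + a.+1)%N%:R ^+ 2 - (2 * k + b.+1)%N%:R ^+ 2 - (a.+1%:R ^+ 2 - b.+1%:R ^+ 2).
Proof.
rewrite /box_eigenvalue /sphere_eigenvalue /=.
have -> : (j + a.+2 - 1 = j + a.+1)%N by lia.
have -> : (k + b.+2 - 1 = k + b.+1)%N by lia.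
rewrite !natrM !natrD; ring.
Qed.

(** Where the term was set to 0, [t] is bounded, so K t^(a+b+2) is at most a
multiple of t^(a+b+1) and fits in the error term. *)
Lemma row_term_approx {R : realType} a b : odd (a + b) -> exists2 C : R, 0 <= C &
  forall i k (m t : R), m = (2 * i + 1)%N%:R ->
  t = (2 * i + 1 + 2 * b.+1)%N%:R + k%:R * 4 ->
  `|row_term R a b i k - leading_coef R a b * t ^+ (a + b).+2|
     <= C * m * t ^+ (a + b).+1.
Proof.
move=> ab; have [C C0 H] := @multiplicity_approx R a b.
have K0 : 0 <= leading_coef R a b by exact: leading_coef_ge0.
set K := leading_coef R a b in K0 *.
(* Here t = u + v is less than 2 (a + 1) if there is no j, and
   t <= m t <= (a + 1)^2 - (b + 1)^2 if the eigenvalue is not positive. *)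
exists (C + K * (2 * a.+1 * a.+1)%N%:R) => [|i k m t mE t_E].
  by rewrite addr_ge0 ?mulr_ge0.
have m1 : 1 <= m by rewrite mE ler1n; lia.
have t0 : 0 <= t by rewrite t_E addr_ge0 ?mulr_ge0.
have tn0 : 0 <= t ^+ (a + b).+1 by exact: exprn_ge0.
have small : t <= (2 * a.+1 * a.+1)%N%:R -> `|0 - K * t ^+ (a + b).+2|
     <= (C + K * (2 * a.+1 * a.+1)%N%:R) * m * t ^+ (a + b).+1.
  move=> tB; rewrite sub0r normrN ger0_norm ?mulr_ge0 ?exprn_ge0 //.
  rewrite exprS mulrA ler_wpM2r //.
  have h := ler_wpM2l K0 tB.
  rewrite (le_trans h) // (@le_trans _ _ (C + K * (2 * a.+1 * a.+1)%N%:R)) ?lerDr //.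
  by rewrite ler_peMr // addr_ge0 ?mulr_ge0.
have tN : t = (2 * i + 1 + 2 * b.+1 + k * 4)%N%:R.
  by rewrite t_E (natrD _ (2 * i + 1 + 2 * b.+1)) natrM.
rewrite /row_term.
case: (boolP (uphalf a.+1 <= k + i + (b.+1)./2.+1)%N) => ik; last first.
  rewrite andFb.
  apply: small; rewrite tN ler_nat.
  have := odd_double_half a; have := odd_double_half b; move: ab; rewrite oddD.
  by move: ik; rewrite !uphalf_half /=; case: (odd a); case: (odd b) => //=; nia.
have E := (row_indexP a b i (row_index a b i k) k ab).2 (conj ik erefl).
case: ltP => l0.
  have tE : t = (2 * row_index a b i k + a.+1 + (2 * k + b.+1))%N%:R.
    by rewrite tN E; congr (_%:R); lia.
  apply: le_trans (H i _ k m t E mE tE) _.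
  rewrite ler_wpM2r // ler_wpM2r //; first lra.
  by rewrite lerDl mulr_ge0.
apply: small; have := box_eigenvalueE (R := R) a b (row_index a b i k) k.
rewrite E natrD -mE; set v : R := (2 * k + b.+1)%N%:R => lE.
have tv : t = m + 2 * v by rewrite tN mE /v !natrD !natrM; ring.
have tmt : t <= m * t by rewrite ler_peMl.
have b2 : 0 <= b.+1%:R ^+ 2 :> R by rewrite exprn_ge0.
have a2 : 0 <= a.+1%:R ^+ 2 :> R by rewrite exprn_ge0.
rewrite -mulnA natrM natrM -expr2.
have mtE : m * t = (v + m) ^+ 2 - v ^+ 2 by rewrite tv; ring.
lra.
Qed.

(** * The odd part of the zeta series *)

(** Compare 1/x^2 with 2/(x (x+1)) = 2/x - 2/(x+1), whose sum telescopes. *)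
Lemma sum_inv_sqr_le2 {R : realFieldType} (M : nat) :
  \sum_(i < M) i.+1%:R ^- 2 <= 2 :> R.
Proof.
suff H : \sum_(i < M) i.+1%:R ^- 2 <= 2 - 2 / M.+1%:R :> R.
  by apply: le_trans H _; rewrite gerBl divr_ge0.
elim: M => [|M IH]; first by rewrite big_ord0 divr1 subrr.
rewrite big_ord_recr /=; apply: le_trans (lerD IH (lexx _)) _.
have x1 : 1 <= M.+1%:R :> R by rewrite ler1n.
rewrite -[M.+2]addn1 natrD; set x : R := M.+1%:R in x1 *.
have -> : 2 - 2 / (x + 1) = 2 - 2 / x + 2 / (x * (x + 1)) by field; lra.
rewrite lerD2l ler_pdivlMr ?mulr_gt0; try lra.
rewrite ler_pdivrMl ?exprn_gt0; try lra.
by rewrite expr2; nra.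
Qed.

Lemma zeta_nat_term {R : realType} (n k : nat) :
  k.+1%:R `^ (- n%:R) = k.+1%:R ^- n :> R.
Proof. by rewrite powRN powR_mulrn. Qed.

Lemma is_cvg_zeta_series {R : realType} (n : nat) : (2 <= n)%N ->
  cvgn (series (fun k : nat => k.+1%:R `^ (- n%:R) : R)).
Proof.
move=> n2; apply: nondecreasing_is_cvgn.
  apply: nondecreasing_series => k _ _; exact: powR_ge0.
exists 2 => _ [M _ <-]; rewrite /series /= big_mkord.
apply: le_trans (sum_inv_sqr_le2 M); apply: ler_sum => k _.
rewrite zeta_nat_term lef_pV2 ?posrE ?exprn_gt0 //.
by rewrite ler_weXn2l // ler1n.
Qed.

(** The even terms of the zeta series form 2^(-n) times the whole series. *)
Lemma cvg_odd_zeta {R : realType} (n : nat) : (2 <= n)%N ->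
  \sum_(i < M) (2 * i + 1)%N%:R ^- n @[M --> \oo]
    --> (1 - 2 ^- n) * zeta (n%:R : R).
Proof.
move=> n2; set f := fun k : nat => k.+1%:R `^ (- n%:R) : R.
have fc : series f @ \oo --> zeta (n%:R : R) by exact: is_cvg_zeta_series.
have E M : \sum_(i < M) (2 * i + 1)%N%:R ^- n = series f (M * 2)%N - 2 ^- n * series f M.
  rewrite /series /=; elim: M => [|M IH].
    by rewrite mul0n big_ord0 !big_nil mulr0 subrr.
  have -> : (M.+1 * 2 = (M * 2).+2)%N by lia.
  rewrite big_ord_recr /= IH !big_nat_recr //= /f !zeta_nat_term.
  have -> : (M * 2).+2%:R ^- n = 2 ^- n * M.+1%:R ^- n :> R.
    by rewrite -invfM -exprMn -natrM; congr ((_ %:R ^+ _)^-1); lia.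
  have -> : (2 * M + 1 = (M * 2).+1)%N by lia.
  by ring.
rewrite (_ : (fun M => _) = (fun M => series f (M * 2)%N - 2 ^- n * series f M)); last first.
  exact/funext.
rewrite mulrBl mul1r; apply: cvgB; last exact: cvgZr.
apply: cvg_comp fc.
apply/cvgnyPge => A; near=> M; rewrite muln2 -addnn (@leq_trans M) ?leq_addr //.
by near: M; exact: nbhs_infty_ge.
Unshelve. all: by end_near.
Qed.

(** * Summation over the hyperbola region *)

(** One row of the hyperbola region: [g k] is replaced by its leading term, and
the power sum by its asymptotic value at [X = Y / m]. *)
Lemma hyperbola_row {R : realType} (d : nat) (K C m a Y : R) (M : nat) (g : nat -> R) :
  0 <= K -> 0 <= C -> 1 <= m -> 1 <= a -> 0 <= Y -> Y < M%:R ->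
  (forall k t, t = a + k%:R * 4 -> `|g k - K * t ^+ d.+1| <= C * m * t ^+ d) ->
  `|\sum_(k < M | m * (a + k%:R * 4) <= Y) g k
     - K * ((Y / m) ^+ d.+2 / (4 * d.+2%:R))|
  <= (C * m + K * ((5 ^+ d.+1 + 1) * a)) * (Y / m) ^+ d.+1.
Proof.
move=> K0 C0 m1 a1 Y0 YM gE; set X := Y / m.
have m0 : 0 < m by lra.
have X0 : 0 <= X by rewrite divr_ge0 // ltW.
have XY : X <= Y by rewrite ler_pdivrMr // ler_peMr.
have XM : X < a + M%:R * 4 by have : 0 <= M%:R :> R by []; lra.
have cE (k : nat) : (m * (a + k%:R * 4) <= Y) = (a + k%:R * 4 <= X).
  by rewrite ler_pdivlMr // mulrC.
rewrite (eq_bigl _ _ (fun k : 'I_M => cE k)).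
have -> : \sum_(k < M | a + k%:R * 4 <= X) g k =
   \sum_(k < M | a + k%:R * 4 <= X) (g k - K * (a + k%:R * 4) ^+ d.+1)
   + K * \sum_(k < M | a + k%:R * 4 <= X) (a + k%:R * 4) ^+ d.+1.
  by rewrite mulr_sumr -big_split /=; apply: eq_bigr => k _; rewrite subrK.
rewrite -addrA -mulrBr [leRHS]mulrDl.
apply: le_trans (ler_normD _ _) _; apply: lerD; last first.
  by rewrite normrM (ger0_norm K0) -mulrA ler_wpM2l // sum_pow_arith_prog.
apply: le_trans (ler_norm_sum _ _ _) _.
have h : \sum_(k < M | a + k%:R * 4 <= X) C * m * (a + k%:R * 4) ^+ d
    <= C * m * X ^+ d.+1.
  by rewrite -mulr_sumr ler_wpM2l ?mulr_ge0 ?(ltW m0) // sum_pow_arith_prog_le.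
by apply: le_trans h; apply: ler_sum => k _; apply: gE.
Qed.

(** The partial sums stabilize at [S] once the box [M] contains the hyperbola
region, whereas the sum of the m^-(d+2) over [i < M] keeps growing.  The estimate
is uniform in [M], so letting [M] tend to infinity replaces the latter by its
limit.  The row errors are at most a multiple of Y^(d+1) m^(-d), and they are
summable because [2 <= d]. *)
Lemma hyperbola_sum {R : realType} (d b : nat) (K C : R) (g : nat -> nat -> R) :
  (2 <= d)%N -> 0 <= K -> 0 <= C ->
  (forall i k (m t : R), m = (2 * i + 1)%N%:R ->
    t = (2 * i + 1 + 2 * b.+1)%N%:R + k%:R * 4 ->
    `|g i k - K * t ^+ d.+1| <= C * m * t ^+ d) ->
  exists2 C' : R, 0 <= C' & forall (Y S : R) (M0 : nat), 0 <= Y ->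
  (forall M, (M0 <= M)%N ->
    \sum_(i < M) \sum_(k < M | (2 * i + 1)%N%:R *
        ((2 * i + 1 + 2 * b.+1)%N%:R + k%:R * 4) <= Y) g i k = S) ->
  `|S - K * Y ^+ d.+2 / (4 * d.+2%:R) * ((1 - 2 ^- d.+2) * zeta (d.+2%:R : R))|
    <= C' * Y ^+ d.+1.
Proof.
move=> d2 K0 C0 gE.
pose B := (C + K * ((5 ^+ d.+1 + 1) * (1 + 2 * b.+1)%N%:R)).
have B0 : 0 <= B by rewrite addr_ge0 // mulr_ge0 // mulr_ge0 // addr_ge0 // exprn_ge0.
exists (B * 2) => [|Y S M0 Y0 HS]; first by rewrite mulr_ge0.
have Y10 : 0 <= Y ^+ d.+1 by rewrite exprn_ge0.
set W := K * Y ^+ d.+2 / (4 * d.+2%:R).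
have fin M : (M0 <= M)%N -> Y < M%:R ->
  `|S - W * \sum_(i < M) (2 * i + 1)%N%:R ^- d.+2| <= B * 2 * Y ^+ d.+1.
  move=> MM YM; rewrite -(HS M MM) mulr_sumr -sumrB.
  apply: le_trans (ler_norm_sum _ _ _) _.
  have h : \sum_(i < M) B * Y ^+ d.+1 * i.+1%:R ^- 2 <= B * 2 * Y ^+ d.+1.
    by rewrite -mulr_sumr [leRHS]mulrAC ler_wpM2l ?mulr_ge0 // sum_inv_sqr_le2.
  apply: le_trans h; apply: ler_sum => i _.
  set m : R := (2 * i + 1)%N%:R.
  have m1 : 1 <= m by rewrite ler1n; lia.
  have m0 : 0 < m by lra.
  have a1 : 1 <= (2 * i + 1 + 2 * b.+1)%N%:R :> R by rewrite ler1n; lia.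
  have := hyperbola_row d K C m _ Y M (g i) K0 C0 m1 a1 Y0 YM
    (fun k t => gE i k m t erefl).
  have -> : K * ((Y / m) ^+ d.+2 / (4 * d.+2%:R)) = W * m ^- d.+2.
    by rewrite /W expr_div_n; field; rewrite expf_eq0 /= lt0r_neq0 //= !pnatr_eq0.
  move=> h; apply: le_trans h _.
  have -> : B * Y ^+ d.+1 * i.+1%:R ^- 2 = B * (Y ^+ d.+1 * i.+1%:R ^- 2) by ring.
  (* The first term of row i is at most (1 + 2 (b + 1)) m. *)
  apply: (@le_trans _ _ (B * m * (Y / m) ^+ d.+1)).
    rewrite ler_wpM2r ?exprn_ge0 ?divr_ge0 ?(ltW m0) // /B.
    rewrite [leRHS]mulrDl lerD2l -mulrA ler_wpM2l // -mulrA.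
    rewrite ler_wpM2l ?addr_ge0 ?exprn_ge0 // /m -natrM ler_nat; nia.
  rewrite -mulrA ler_wpM2l // expr_div_n mulrCA ler_wpM2l //.
  have -> : m / m ^+ d.+1 = m ^- d.
    by rewrite exprS invfM mulrA divff ?mul1r // lt0r_neq0.
  rewrite lef_pV2 ?posrE ?exprn_gt0 //.
  apply: (@le_trans _ _ (m ^+ 2)); last by rewrite ler_weXn2l.
  by rewrite lerXn2r ?nnegrE // /m ler_nat; lia.
have cv : `|S - W * \sum_(i < M) (2 * i + 1)%N%:R ^- d.+2| @[M --> \oo]
    --> `|S - W * ((1 - 2 ^- d.+2) * zeta (d.+2%:R : R))|.
  apply: cvg_norm; apply: cvgB; first exact: cvg_cst.
  by apply: cvgZr; apply: cvg_odd_zeta.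
apply: (ler_cvg_to cv (cvg_cst (B * 2 * Y ^+ d.+1))).
near=> M; apply: fin; first by near: M; exact: nbhs_infty_ge.
near: M; exact: nbhs_infty_gtr.
Unshelve. all: by end_near.
Qed.

(** * From eigenvalue counts to the hyperbola region *)

Lemma esum_box {R : realType} (P : pred (nat * nat)) (F : nat * nat -> R) M :
  (forall x, 0 <= F x) -> (forall i k, P (i, k) -> (i < M)%N && (k < M)%N) ->
  (\esum_(x in [set x | P x]) (F x)%:E =
    (\sum_(i < M) \sum_(k < M | P ((i : nat), (k : nat))) F ((i : nat), (k : nat)))%:E)%E.
Proof.
move=> F0 PM; rewrite esum_mkcond.
pose r := [seq x <- [seq (i, k) | i <- index_iota 0 M, k <- index_iota 0 M] | P x].
have rE : [set x | P x] = [set` r].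
  apply/seteqP; split => -[i k] /=; rewrite /r mem_filter => //; last by case/andP.
  move=> Pik; rewrite Pik /=; have /andP[iM kM] := PM _ _ Pik.
  by apply: allpairs_f; rewrite mem_index_iota.
have ur : uniq r.
  by rewrite filter_uniq // allpairs_uniq ?iota_uniq // => -[? ?] [? ?] _ _ [-> ->].
rewrite -esum_mkcond rE esum_fset; last by move=> x _; rewrite lee_fin.
  rewrite -fsbig_seq // sumEFin; congr (_%:E).
  rewrite big_filter big_mkcond big_allpairs_dep /=.
  rewrite big_mkord; apply: eq_bigr => i _.
  by rewrite big_mkord -big_mkcond.
exact: finite_seq.
Qed.

Lemma NplusE {R : realType} p q (s : R) : Nplus p q s =
  (\esum_(jk in [set jk | (0 < box_eigenvalue R p q jk <= s)%R])
    (harmonic_dim R p jk.1 * harmonic_dim R q jk.2)%:E)%E.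
Proof.
by rewrite /Nplus /box_count; congr (esum _ _).
Qed.

Lemma Nminus_swap {R : realType} p q (s : R) : Nminus p q s = Nplus q p s.
Proof.
rewrite NplusE /Nminus /box_count.
rewrite (@reindex_esum R _ _ [set jk | (0 < box_eigenvalue R q p jk <= s)%R] _
  (fun jk => (jk.2, jk.1))).
  by apply: eq_esum => -[j k] _ /=; rewrite mulrC.
have E j k : box_eigenvalue R p q (j, k) = - box_eigenvalue R q p (k, j).
  by rewrite /box_eigenvalue /= opprB.
split.
- move=> [k j] /=; rewrite in_itv /= E => /andP[l0 ls].
  by rewrite lerN2 ls oppr_lt0.
- by move=> [? ?] [? ?] _ _ [-> ->].
- move=> [j k] /=; rewrite in_itv /= E lerN2 oppr_lt0 => /andP[ls l0].
  by exists (k, j) => //=; rewrite l0.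
Qed.

Lemma harmonic_dim_ge0 {R : realType} r m : 0 <= harmonic_dim R r m.
Proof. by rewrite /harmonic_dim mulr_ge0 // divr_ge0. Qed.

Lemma row_eigenvalueE {R : realType} a b i k : odd (a + b) ->
  (uphalf a.+1 <= k + i + (b.+1)./2.+1)%N ->
  4 * box_eigenvalue R a.+2 b.+2 (row_index a b i k, k) =
  (2 * i + 1)%N%:R * ((2 * i + 1 + 2 * b.+1)%N%:R + k%:R * 4)
  - (a.+1%:R ^+ 2 - b.+1%:R ^+ 2).
Proof.
move=> ab ik; rewrite box_eigenvalueE.
rewrite ((row_indexP a b i (row_index a b i k) k ab).2 (conj ik erefl)).
by rewrite !natrD !natrM; ring.
Qed.

(** [S] collects the eigenvalues with u > v and [E] those with u < v.  In the
second case 0 < 4 lambda gives u + v <= v^2 - u^2 < (q-1)^2, so these pairs lie in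
a box that does not depend on [s]. *)
Lemma Nplus_decomposition {R : realType} a b : odd (a + b) ->
  exists2 C0 : R, 0 <= C0 & forall s : R,
  let Y := 4 * s + (a.+1%:R ^+ 2 - b.+1%:R ^+ 2) in
  exists S E : R, [/\ Nplus a.+2 b.+2 s = (S + E)%:E, 0 <= E <= C0 &
  forall M, (Num.Def.archi_bound Y <= M)%N ->
    \sum_(i < M) \sum_(k < M | (2 * i + 1)%N%:R *
        ((2 * i + 1 + 2 * b.+1)%N%:R + k%:R * 4) <= Y) row_term R a b i k = S].
Proof.
move=> ab; have par x y : odd (2 * x + y.+1) = ~~ odd y.
  by rewrite oddD mul2n odd_double.
pose F (jk : nat * nat) := harmonic_dim R a.+2 jk.1 * harmonic_dim R b.+2 jk.2.
have F0 x : 0 <= F x by rewrite mulr_ge0 ?harmonic_dim_ge0.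
pose lam := box_eigenvalue R a.+2 b.+2.
pose W := (b.+1 * b.+1)%N.
exists (\sum_(j < W) \sum_(k < W) F ((j : nat), (k : nat))) => [|s Y].
  by do 2 (apply: sumr_ge0 => ? _).
rewrite NplusE.
rewrite (esumID [set jk : nat * nat | (2 * jk.2 + b.+1 < 2 * jk.1 + a.+1)%N]); last first.
  by move=> jk _; rewrite lee_fin; exact: F0.
pose P1 (ik : nat * nat) := (uphalf a.+1 <= ik.2 + ik.1 + (b.+1)./2.+1)%N
  && (0 < lam (row_index a b ik.1 ik.2, ik.2) <= s).
rewrite (@reindex_esum R _ _ [set ik | P1 ik] _
  (fun ik => (row_index a b ik.1 ik.2, ik.2))); last first.
  split.
  - move=> [i k] /andP[/= ik l0s]; split => //=.
    have := (row_indexP a b i (row_index a b i k) k ab).2 (conj ik erefl); lia.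
  - move=> [i k] [i' k'] /set_mem/andP[/= ik _] /set_mem/andP[/= ik' _] [+ kk].
    move: ik'; rewrite -kk /row_index => ik' h; congr (_, _); lia.
  - move=> [j k] /= [l0s jk].
    pose i := ((2 * j + a.+1 - (2 * k + b.+1)) ./2)%N.
    have E : (2 * j + a.+1 = 2 * k + b.+1 + (2 * i + 1))%N.
      have : odd (2 * j + a.+1 - (2 * k + b.+1)).
        rewrite oddB ?(ltnW jk) // !par; move: ab; rewrite oddD.
        by case: (odd a); case: (odd b).
      have := odd_double_half (2 * j + a.+1 - (2 * k + b.+1)).
      by rewrite -/i => + o; rewrite o; lia.
    have [ik jE] := (row_indexP a b i j k ab).1 E.
    by exists (i, k); rewrite /P1 /= -?jE // ik.
pose P2 (jk : nat * nat) := (0 < lam jk <= s) && ~~ (2 * jk.2 + b.+1 < 2 * jk.1 + a.+1)%N.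
rewrite (_ : _ `&` _ = [set jk | P2 jk]); last first.
  apply/seteqP; split => jk /=; first by case=> l0 /negP h; apply/andP.
  by case/andP => l0 /negP h.
have cE i k : P1 (i, k) -> (2 * i + 1)%N%:R *
        ((2 * i + 1 + 2 * b.+1)%N%:R + k%:R * 4) <= Y.
  case/andP=> /= ik /andP[_ ls]; have := @row_eigenvalueE R a b i k ab ik.
  by rewrite /Y -/(lam _); lra.
(* The second factor exceeds both i and k, and the first is at least 1. *)
have P1box M i k : (Num.Def.archi_bound Y <= M)%N -> P1 (i, k) -> (i < M)%N && (k < M)%N.
  move=> YM /cE h; rewrite -!(ltr_nat R).
  have YM' : Y < M%:R.
    apply: lt_le_trans (archi_boundP _) _; last by rewrite ler_nat.
    by apply: le_trans h; rewrite mulr_ge0 // addr_ge0 // mulr_ge0.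
  have i0 : 0 <= i%:R :> R by []. have k0 : 0 <= k%:R :> R by [].
  have b0 : 0 <= b.+1%:R :> R by [].
  move: h; rewrite !natrD !natrM => h.
  by apply/andP; split; nra.
have P2box j k : P2 (j, k) -> (j < W)%N && (k < W)%N.
  case/andP => /andP[l0 _]; rewrite -leqNgt /= => uv.
  have := @box_eigenvalueE R a b j k; rewrite -/(lam _) => lE.
  have : (2 * k + b.+1)%N%:R ^+ 2 + a.+1%:R ^+ 2
    < (2 * j + a.+1)%N%:R ^+ 2 + b.+1%:R ^+ 2 :> R by lra.
  rewrite -!natrX -!natrD ltr_nat => h.
  (* Without u != v the gap v^2 - u^2 would not bound u + v. *)
  have ne : (2 * j + a.+1 != 2 * k + b.+1)%N.
    apply/eqP => /(congr1 odd); rewrite !par.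
    by move: ab; rewrite oddD; case: (odd a); case: (odd b).
  by rewrite /W; apply/andP; split; nia.
rewrite (@esum_box R P1 (fun ik => F (row_index a b ik.1 ik.2, ik.2))
  (Num.Def.archi_bound Y)) //; last first.
  by move=> i k; exact: P1box.
rewrite (@esum_box R P2 F W) // -EFinD.
eexists; eexists; split; first by reflexivity.
- apply/andP; split; first by do 2 (apply: sumr_ge0 => ? _).
  apply: ler_sum => j _; rewrite big_mkcond; apply: ler_sum => k _.
  by case: ifP.
move=> M YM; apply: EFin_inj.
rewrite -(@esum_box R P1 (fun ik => F (row_index a b ik.1 ik.2, ik.2))
  (Num.Def.archi_bound Y)) //; last first.
  by move=> i k; exact: P1box.
rewrite (@esum_box R P1 (fun ik => F (row_index a b ik.1 ik.2, ik.2)) M) //; last first.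
  by move=> i k; exact: P1box.
congr (_%:E); apply: eq_bigr => i _; rewrite big_mkcond [RHS]big_mkcond.
apply: eq_bigr => k _; case: ifPn => h.
  rewrite (_ : P1 (i : nat, k : nat) = (uphalf a.+1 <= k + i + (b.+1)./2.+1)%N
      && (0 < lam (row_index a b i k, (k : nat)))) //.
  rewrite {1}/P1 [(_, _).1]/= [(_, _).2]/=.
  case: (boolP (uphalf a.+1 <= k + i + (b.+1)./2.+1)%N) => ik; rewrite ?andTb ?andFb //.
  have := @row_eigenvalueE R a b i k ab ik; rewrite -/(lam _) => lE.
  have -> : lam (row_index a b i k, (k : nat)) <= s by move: h; rewrite /Y; lra.
  by rewrite andbT.
by case: ifPn => // /cE; rewrite (negbTE h).
Qed.

(** * Asymptotics *)

Lemma weyl_constantE {R : realType} a b : weyl_constant R a.+2 b.+2 =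
  leading_coef R a b * 4 ^+ (a + b).+3 / (4 * (a + b).+3%:R) *
    ((1 - 2 ^- (a + b).+3) * zeta ((a + b).+3%:R : R)).
Proof.
rewrite /weyl_constant /leading_coef.
have -> : (a.+2 + b.+2 - 1 = (a + b).+3)%N by lia.
rewrite !subn1 [_.-1]/= [X in X`!%:R]/= mulrA; congr (_ * _ * _).
rewrite (exprS 4 (a + b).+2); field.
rewrite !expf_eq0 !pnatr_eq0 -!lt0n !fact_gt0 /=.
by rewrite lt0r_neq0.
Qed.

Lemma Nplus_asymptotics {R : realType} a b : odd (a + b) ->
  exists C : R, \forall s \near +oo_R,
  (`|Nplus a.+2 b.+2 s - (weyl_constant R a.+2 b.+2 * s ^+ (a + b).+3)%:E|
    <= (C * s ^+ (a + b).+2)%:E)%E.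
Proof.
move=> ab; have K0 := leading_coef_ge0 R a b.
have [C C0 HC] := @row_term_approx R a b ab.
have d2 : (2 <= (a + b).+1)%N by case: (a + b)%N ab.
have [C' C'0 HC'] := @hyperbola_sum R _ b _ _ _ d2 K0 C0 HC.
have [E0 E00 HE] := @Nplus_decomposition R a b ab.
rewrite weyl_constantE; set D := (a + b).+2 in HC' *.
set Z := (1 - 2 ^- D.+1) * zeta _ in HC' *; set K := leading_coef R a b in K0 HC' *.
pose c : R := a.+1%:R ^+ 2 + b.+1%:R ^+ 2.
pose V := K / (4 * D.+1%:R) * Z.
exists (E0 + C' * 8 ^+ D + `|V| * (D.+1%:R * c * 8 ^+ D)).
near=> s.
have sc : 1 + c <= s by near: s; apply: nbhs_pinfty_ge; rewrite num_real.
have a2 : 0 <= a.+1%:R ^+ 2 :> R by rewrite exprn_ge0.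
have b2 : 0 <= b.+1%:R ^+ 2 :> R by rewrite exprn_ge0.
have [S [E [-> /andP[E1 E2] HS]]] := HE s.
set Y := 4 * s + _ in HS.
have c0 : 0 <= c by rewrite /c; lra.
have s1 : 1 <= s by lra.
have Y0 : 0 <= Y by rewrite /Y /c in sc *; lra.
have Y8 : Y <= 8 * s by rewrite /Y /c in sc *; lra.
have Yc : `|Y - 4 * s| <= c by rewrite ler_norml /Y /c; apply/andP; split; lra.
have {}HS := HC' Y S _ Y0 HS.
rewrite -EFinB abse_EFin lee_fin.
have sD0 : 0 <= s ^+ D by rewrite exprn_ge0 //; lra.
have sD1 : 1 <= s ^+ D by rewrite exprn_ege1.
have YD : Y ^+ D <= 8 ^+ D * s ^+ D by rewrite -exprMn lerXn2r ?nnegrE //; lra.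
have pw : `|Y ^+ D.+1 - (4 * s) ^+ D.+1| <= D.+1%:R * c * (8 * s) ^+ D.
  have := norm_prod_sub_exp (fun=> Y) (4 * s) (8 * s) c D.
  rewrite prodr_const card_ord; apply => //.
  - by rewrite ger0_norm; lra.
  - by move=> _ _; rewrite ger0_norm.
have -> : S + E - K * 4 ^+ D.+1 / (4 * D.+1%:R) * Z * s ^+ D.+1 =
   E + (S - K * Y ^+ D.+1 / (4 * D.+1%:R) * Z) + V * (Y ^+ D.+1 - (4 * s) ^+ D.+1).
  by rewrite /V exprMn; ring.
have -> : (E0 + C' * 8 ^+ D + `|V| * (D.+1%:R * c * 8 ^+ D)) * s ^+ D =
   E0 * s ^+ D + C' * (8 ^+ D * s ^+ D) + `|V| * (D.+1%:R * c * (8 * s) ^+ D).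
  by rewrite exprMn; ring.
apply: le_trans (ler_normD _ _) _; apply: lerD.
  apply: le_trans (ler_normD _ _) _; apply: lerD.
    by rewrite ger0_norm // (le_trans E2) // ler_peMr.
  by apply: le_trans HS _; rewrite ler_wpM2l.
by rewrite normrM ler_wpM2l.
Unshelve. all: by end_near.
Qed.

Theorem theorem5p4 (R : realType) (p q : nat)
    (p_ge3 : (3 <= p)%N) (p_odd : odd p) (q_ge2 : (2 <= q)%N) (q_even : ~~ odd q) :
  (exists C : R, \forall s \near +oo_R,
     (`|Nplus p q s - (weyl_constant R p q * s ^+ (p + q - 1))%:E|
        <= (C * s ^+ (p + q - 2))%:E)%E) /\
  (exists C : R, \forall s \near +oo_R,
     (`|Nminus p q s - (weyl_constant R p q * s ^+ (p + q - 1))%:E|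
        <= (C * s ^+ (p + q - 2))%:E)%E).
Proof.
case: p p_ge3 p_odd => [|[|a]] // _ a_odd; case: q q_ge2 q_even => [|[|b]] // _ b_even.
have ab : odd (a + b).
  by rewrite oddD; move: a_odd b_even => /=; rewrite !negbK => -> /negbTE->.
have -> : (a.+2 + b.+2 - 1 = (a + b).+3)%N by lia.
have -> : (a.+2 + b.+2 - 2 = (a + b).+2)%N by lia.
split; first exact: Nplus_asymptotics.
have Wsym : weyl_constant R a.+2 b.+2 = weyl_constant R b.+2 a.+2.
  by rewrite /weyl_constant (addnC a.+2) -!mulrA [_`!%:R * _]mulrC.
have ba : odd (b + a) by rewrite addnC.
have [C HC] := @Nplus_asymptotics R b a ba.
exists C; move: HC; rewrite (addnC b a) -Wsym; apply: filterS => s.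
by rewrite Nminus_swap.
Qed.
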